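(* Let $n\ge 1$ and $m\ge 0$ be integers and let $q$ be an indeterminate. Then $$(1+(1+q)m)^n=\sum_{k=0}^n\binom{n+m-k}{n}B_{n,k}(q),$$ where $B_{n,k}(q)=\sum_{\pi\in B_n,\ \mathrm{des}_B(\pi)=k}q^{\mathrm{neg}(\pi)}$ is the $q$-Eulerian number of type $B$.
   Context: $B_n$ is the group of signed permutations: bijections $\pi$ of $\{\pm1,\dots,\pm n\}$ with $\pi(-i)=-\pi(i)$ for all $i$. For $\pi\in B_n$, let $\mathrm{Des}_A(\pi)=\{i: 1\le i\le n-1,\ \pi(i)>\pi(i+1)\}$ (usual order on integers). Let $\mathrm{Des}_B(\pi)=\mathrm{Des}_A(\pi)\cup\{0\}$ if $\pi(1)<0$, and $\mathrm{Des}_B(\pi)=\mathrm{Des}_A(\pi)$ if $\pi(1)>0$. Put $\mathrm{des}_B(\pi)=|\mathrm{Des}_B(\pi)|$ and $\mathrm{neg}(\pi)=|\{i:1\le i\le n,\ \pi(i)<0\}|$. The binomial coefficient $\binom{a}{n}$ with $0\le a<n$ is $0$. *)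

(* Defs.v *)
From HB Require Import structures.
From mathcomp Require Import all_boot all_order all_algebra all_fingroup.
Set Implicit Arguments.
Unset Strict Implicit.
Unset Printing Implicit Defensive.
Import Order.TTheory GRing.Theory Num.Theory.
Local Open Scope ring_scope.

(* The set {±1, ..., ±n}: the pair (b, j) stands for the integer
   (-1)^b * (j + 1), so b = true marks the negative elements. *)
Definition pm (n : nat) : finType := (bool * 'I_n)%type.

Definition pm_val n (x : pm n) : int := (-1) ^+ x.1 * (x.2.+1)%:Z.

Definition pm_opp n (x : pm n) : pm n := (~~ x.1, x.2).

Definition signed_perms (n : nat) : {set {perm (pm n)}} :=
  [set s : {perm (pm n)} | [forall x, s (pm_opp x) == pm_opp (s x)]].

(* One-line notation: the integers s(1), ..., s(n) in this order. *)
Definition window n (s : {perm (pm n)}) : seq int :=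
  [seq pm_val (s (false, j)) | j <- enum 'I_n].

(* The integer s(i), meaningful only for 1 <= i <= n. *)
Definition sp_at n (s : {perm (pm n)}) (i : nat) : int :=
  nth 0 (window s) i.-1.

(* Positions 0, ..., n are typed in 'I_n.+1 so that positions are literally
   the integers used for descents (0 included) and for the values s(i). *)
Definition DesA n (s : {perm (pm n)}) : {set 'I_n.+1} :=
  [set i : 'I_n.+1 | (1 <= i <= n.-1)%N && (sp_at s i > sp_at s i.+1)].

Definition DesB n (s : {perm (pm n)}) : {set 'I_n.+1} :=
  if sp_at s 1 < 0 then ord0 |: DesA s else DesA s.

Definition desB n (s : {perm (pm n)}) : nat := #|DesB s|.

Definition neg n (s : {perm (pm n)}) : nat :=
  #|[set i : 'I_n.+1 | (1 <= i <= n)%N && (sp_at s i < 0)]|.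

Definition eulerB (n k : nat) : {poly int} :=
  \sum_(s in signed_perms n | desB s == k) 'X^(neg s).

(* Main.v *)
(* Expanding the left side gives a sum over the maps f from {1, ..., n} to
   {-m, ..., m} of q^(number of negative values).  Sorting the indices j by
   |f(j)|, ties being broken by j signed like f(j), attaches to f a unique
   signed permutation pi whose letters carry the signs of f.  Conversely, the
   maps attached to pi are the weakly increasing sequences
   c_1 <= ... <= c_n in {0, ..., m} with a strict step from c_i to c_(i+1) at
   every descent i of pi, where c_0 = 0; there are 'C(n + m - des_B pi, n) of
   them. *)
Require Import Defs.
From HB Require Import structures.
From mathcomp Require Import all_boot all_order all_algebra all_fingroup.
From mathcomp Require Import zify.
Set Implicit Arguments.
Unset Strict Implicit.
Unset Printing Implicit Defensive.
Import Order.TTheory GRing.Theory Num.Theory.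
Local Open Scope ring_scope.

(** * Sequences with prescribed strict steps, and sorting by distinct keys *)

Lemma nth_map_enum_ord (T : Type) (x0 : T) n (F : 'I_n -> T) (i : 'I_n) :
  nth x0 [seq F j | j <- enum 'I_n] i = F i.
Proof. by rewrite (nth_map i) ?size_enum_ord ?nth_ord_enum. Qed.

(** This is monotonicity of u - v, written additively because subtraction on [nat] truncates. *)
Lemma leq_telescope (u v : nat -> nat) (n : nat) :
    (forall k, k < n -> u k + v k.+1 <= u k.+1 + v k)%N ->
  forall i j, (i <= j <= n)%N -> (u i + v j <= u j + v i)%N.
Proof.
move=> step i; elim=> [|j IHj] /andP[le_ij le_jn].
  by move: le_ij; rewrite leqn0 => /eqP->.
move: le_ij; rewrite leq_eqVlt => /orP[/eqP-> //|lt_ij].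
have := IHj _; have := step j le_jn; lia.
Qed.

Section StepSequences.

Variables (n m : nat) (D : nat -> bool).

Let d k := (\sum_(0 <= i < k) D i)%N.

Let d0 : d 0 = 0%N.
Proof. by rewrite /d big_geq. Qed.

Let dS k : d k.+1 = (d k + D k)%N.
Proof. by rewrite /d big_nat_recr. Qed.

Let d_mono i j : (i <= j)%N -> (d i <= d j)%N.
Proof.
by move=> le_ij; rewrite {2}/d (big_cat_nat (leq0n i) le_ij) //= -/(d i) leq_addr.
Qed.

Let d_le k : (d k <= k)%N.
Proof. by elim: k => [|k IH]; rewrite ?d0 // dS; lia. Qed.

(** The prepended 0 is c_0: index [i] of the extended list is the predecessor of [c i], and [D i]
    forces a strict step into [c i]. *)
Definition step_seqs : {set {ffun 'I_n -> 'I_m.+1}} :=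
  [set c : {ffun 'I_n -> 'I_m.+1} | [forall i : 'I_n,
     nth 0 (0 :: [seq val (c j) | j <- enum 'I_n]) i + D i <= c i]%N].

Let ext (c : {ffun 'I_n -> 'I_m.+1}) k :=
  nth 0%N (0%N :: [seq val (c j) | j <- enum 'I_n]) k.

Let ext0 c : ext c 0 = 0%N. Proof. by []. Qed.

Let extS c (i : 'I_n) : ext c i.+1 = c i.
Proof. by rewrite /ext /= nth_map_enum_ord. Qed.

Let ext_gap c : c \in step_seqs ->
  forall i j, (i <= j <= n)%N -> (ext c i + d j <= ext c j + d i)%N.
Proof.
rewrite inE => /forallP cP; apply: leq_telescope => k lt_kn.
have := cP (Ordinal lt_kn); rewrite -extS /= -/(ext c k) dS; lia.
Qed.

Let ltn_sorted_gap N (t : n.-tuple 'I_N) : sorted ltn [seq val i | i <- t] ->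
  forall i j : 'I_n, (i <= j)%N -> (tnth t i + j <= tnth t j + i)%N.
Proof.
move=> t_sorted i j le_ij.
pose u k := nth 0%N [seq val i | i <- t] k.
have uE (l : 'I_n) : u l = tnth t l.
  by rewrite /u (nth_map (tnth t l)) ?size_tuple // -tnth_nth.
have step k : (k < n.-1)%N -> (u k + k.+1 <= u k.+1 + k)%N.
  move=> lt_kn.
  have/sortedP -/(_ 0%N k) := t_sorted.
  rewrite size_map size_tuple -/(u k) -/(u k.+1); lia.
rewrite -!uE; apply: (leq_telescope (v := id) step); have := ltn_ord j; lia.
Qed.

(* Adding [i] minus the number of forced steps up to position [i] turns the
   constraints [c_(i-1) + D i <= c_i] into strict increase. *)
Lemma card_step_seqs :
  (0 < n)%N -> #|step_seqs| = 'C(n + m - \sum_(0 <= i < n) D i, n).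
Proof.
move=> n_gt0; rewrite -/(d n) -card_ltn_sorted_tuples.
set N := (n + m - d n)%N; have dn := d_le n.
apply/eqP; rewrite eqn_leq; apply/andP; split.
  (* A member [c0] forces [N] to be positive, which the use of [inord] requires. *)
  have [->|[c0 c0A]] := set_0Vmem step_seqs; first by rewrite cards0.
  have bnd c (i : 'I_n) : c \in step_seqs ->
      (d i.+1 <= c i)%N /\ (c i + i - d i.+1 < N)%N.
    move=> cA; have lt_in := ltn_ord i.
    (* The gap up to the last entry, itself at most [m], bounds c_i - d_(i+1) by m - d_n. *)
    have := ext_gap cA (i := 0) (j := i.+1); have := ext_gap cA (i := i.+1) (j := n).
    have := ltn_ord (c (Ordinal (n := n) (m := n.-1) (ltac:(lia)))).
    rewrite -!extS /= prednK // ext0 d0 /N.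
    lia.
  have N_gt0 : (0 < N)%N by have [_] := bnd c0 (Ordinal n_gt0) c0A; lia.
  have NE : N.-1.+1 = N by rewrite prednK.
  pose h (c : {ffun 'I_n -> 'I_m.+1}) : n.-tuple 'I_N :=
    [tuple cast_ord NE (inord (c i + i - d i.+1)) | i < n].
  have hE c i : c \in step_seqs -> tnth (h c) i = (c i + i - d i.+1)%N :> nat.
    by move=> cA; rewrite tnth_mktuple /= inordK // NE; case: (bnd c i cA).
  rewrite -(@card_in_imset _ _ h) => [|c c' cA c'A ecc'].
    apply/subset_leq_card/subsetP=> _ /imsetP[c cA ->].
    rewrite inE; apply/(sortedP 0%N) => k; rewrite size_map size_tuple => lt_kn.
    have lt_k : (k < n)%N by lia.
    have hk l (lt_ln : (l < n)%N) : nth 0%N [seq val i | i <- h c] l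
        = (ext c l.+1 + l - d l.+1)%N.
      rewrite -[l]/(val (Ordinal lt_ln)).
      rewrite (nth_map (tnth (h c) (Ordinal lt_ln))) ?size_tuple //.
      by rewrite -tnth_nth extS; apply: hE.
    rewrite !hk //.
    have := ext_gap cA (i := k.+1) (j := k.+2); have := ext_gap cA (i := 0) (j := k.+1).
    rewrite ext0 d0; lia.
  apply/ffunP=> i; apply: ord_inj.
  have : (c i + i - d i.+1 = c' i + i - d i.+1)%N by rewrite -!hE // ecc'.
  have [] := bnd c i cA; have [] := bnd c' i c'A; lia.
set S := [set t | _].
pose h (t : n.-tuple 'I_N) : {ffun 'I_n -> 'I_m.+1} :=
  [ffun i => inord (tnth t i + d i.+1 - i)].
have bnd t (i : 'I_n) : t \in S -> (i <= tnth t i)%N /\ (tnth t i + d i.+1 - i < m.+1)%N.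
  rewrite inE => /ltn_sorted_gap gap; have lt_in := ltn_ord i.
  (* Strict increase from the first entry gives the lower bound; strict increase up to the last
     entry, which is below [N], gives the upper one. *)
  have lt_n1 : (n.-1 < n)%N by lia.
  have := gap (Ordinal n_gt0) i; have := gap i (Ordinal lt_n1).
  have := ltn_ord (tnth t (Ordinal lt_n1)); have := d_mono lt_in.
  rewrite /= /N; lia.
have hE t i : t \in S -> h t i = (tnth t i + d i.+1 - i)%N :> nat.
  by move=> tS; rewrite ffunE inordK //; case: (bnd t i tS).
rewrite -(@card_in_imset _ _ h) => [|t t' tS t'S ett'].
  apply/subset_leq_card/subsetP=> _ /imsetP[t tS ->].
  rewrite inE; apply/forallP=> i; rewrite hE // dS.
  have [le_it _] := bnd t i tS.
  case: i le_it => -[|k] lt_kn /= le_kt; first by lia.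
  have lt_k := ltnW lt_kn.
  rewrite -[k]/(val (Ordinal lt_k)) nth_map_enum_ord hE //= dS.
  have [+ _] := bnd t (Ordinal lt_k) tS.
  have := tS; rewrite inE => /ltn_sorted_gap /(_ (Ordinal lt_k) (Ordinal lt_kn)) /=.
  lia.
apply/eq_from_tnth=> i; apply: ord_inj.
have : (tnth t i + d i.+1 - i = tnth t' i + d i.+1 - i)%N by rewrite -!hE // ett'.
have [] := bnd t i tS; have [] := bnd t' i t'S; lia.
Qed.

End StepSequences.

(** Sorting the values of [K] yields one such permutation. A strictly sorted list is determined by
    its members, and injectivity of [K] recovers the permutation from the list. *)
Lemma card_sorting_perms disp (T : orderType disp) n (K : 'I_n -> T) :
  injective K ->
  #|[set s : 'S_n | sorted <%O [seq K (s i) | i <- enum 'I_n]]| = 1.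
Proof.
move=> K_inj; apply/eqP/cards1P.
pose t := [tuple K i | i < n].
have /tuple_permP[s0 s0E] : perm_eq (sort_tuple <=%O t) t.
  by rewrite /= perm_sort.
have tE (s : 'S_n) : [tuple tnth t (s i) | i < n] =
    [seq K (s i) | i <- enum 'I_n] :> seq T.
  by apply: eq_map => i; rewrite tnth_mktuple.
have uniq_s (s : 'S_n) : uniq [seq K (s i) | i <- enum 'I_n].
  by rewrite map_inj_uniq ?enum_uniq // => i j /K_inj /perm_inj.
have sortedE (s : 'S_n) : sorted <%O [seq K (s i) | i <- enum 'I_n] =
    sorted <=%O [seq K (s i) | i <- enum 'I_n].
  by rewrite lt_sorted_uniq_le uniq_s.
have s0_sorted : sorted <%O [seq K (s0 i) | i <- enum 'I_n].
  by rewrite sortedE -tE -s0E; apply: sort_sorted; apply: le_total.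
exists s0; apply/setP=> s; rewrite !inE; apply/idP/eqP=> [s_sorted|->//].
have eq_s : [seq K (s i) | i <- enum 'I_n] = [seq K (s0 i) | i <- enum 'I_n].
  apply: lt_sorted_eq => //; apply: perm_mem.
  have perm_t (s1 : 'S_n) : perm_eq [seq K (s1 i) | i <- enum 'I_n] t.
    by apply/tuple_permP; exists s1; rewrite tE.
  by rewrite (permPl (perm_t s)) perm_sym.
apply/permP=> i; apply: K_inj.
by rewrite -(nth_map_enum_ord (K i) (fun i => K (s i))) eq_s nth_map_enum_ord.
Qed.

(** * Signed permutations as pairs, and their statistics *)

Lemma pm_val_lt0 n (x : pm n) : (pm_val x < 0) = x.1.
Proof. by case: x => [[] j]; rewrite /pm_val /= ?expr1 ?expr0; lia. Qed.

Lemma pm_val_inj n : injective (@pm_val n).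
Proof.
move=> [b i] [c j]; rewrite /pm_val /=.
case: b; case: c; rewrite ?expr1 ?expr0 => eq_bc; congr pair; try apply: val_inj => /=; lia.
Qed.

Lemma nth_window n (s : {perm (pm n)}) (i : 'I_n) :
  nth 0 (window s) i = pm_val (s (false, i)).
Proof. by rewrite /window nth_map_enum_ord. Qed.

(** Under the convention s(0) = 0, a negative first entry is an ordinary descent at 0, so index [i]
    compares s(i+1) with s(i). *)
Lemma desB_sum n (s : {perm (pm n)}) : (0 < n)%N ->
  desB s = (\sum_(0 <= i < n) (nth 0 (window s) i < nth 0 (0 :: window s) i)%R)%N.
Proof.
move=> n_gt0; rewrite big_mkord.
pose P i := (nth 0 (window s) i < nth 0 (0 :: window s) i).
have DesBE : DesB s = [set i : 'I_n.+1 | (i < n)%N && P i].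
  apply/setP=> i; rewrite /DesB /sp_at /=; case: ifP => neg0; rewrite !inE;
    case: i => -[|k] lt_k //=; rewrite /P /= -?val_eqE /= ?n_gt0 ?neg0 //=;
    by congr (_ && _); rewrite /=; lia.
rewrite /desB DesBE -sum1dep_card big_mkcond big_ord_recr /= ltnn /= addn0.
by apply: eq_bigr => i _; rewrite ltn_ord /= /P; case: ifP.
Qed.

Lemma neg_sum n (s : {perm (pm n)}) :
  neg s = (\sum_(i < n) (s (false, i)).1)%N.
Proof.
rewrite /neg -sum1dep_card big_mkcond big_ord_recl /= add0n.
apply: eq_bigr => i _; rewrite /bump /= add1n ltn_ord /sp_at /=.
by rewrite nth_window pm_val_lt0; case: (_.1).
Qed.

Section SignedPermOfPair.

Variables (n : nat) (p : 'S_n * {ffun 'I_n -> bool}).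

(** [p.1] holds the absolute values and [p.2] the signs, both indexed by position; the exclusive or
    with the sign of the argument makes the map odd. *)
Definition signed_perm_fun (x : pm n) : pm n := (x.1 (+) p.2 x.2, p.1 x.2).

Lemma signed_perm_fun_inj : injective signed_perm_fun.
Proof.
move=> [b i] [c j] [] /= ebc /perm_inj eij; rewrite eij in ebc *.
by congr pair; apply: (can_inj (addbK (p.2 j))).
Qed.

Definition signed_perm : {perm (pm n)} := perm signed_perm_fun_inj.

Lemma signed_permE b i : signed_perm (b, i) = (b (+) p.2 i, p.1 i).
Proof. by rewrite permE. Qed.

End SignedPermOfPair.

Lemma signed_perm_inj n : injective (@signed_perm n).
Proof.
move=> [s e] [s' e'] eq_se.
have eq_i i : (e i, s i) = (e' i, s' i).
  by have := congr1 (fun t : {perm (pm n)} => t (false, i)) eq_se; rewrite !signed_permE.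
congr pair; [apply/permP | apply/ffunP] => i; by case: (eq_i i).
Qed.

Lemma signed_permsE n : signed_perms n = @signed_perm n @: setT.
Proof.
apply/setP=> s; apply/idP/imsetP=> [|[p _ ->]]; last first.
  rewrite inE; apply/forallP=> -[b i]; rewrite /pm_opp !signed_permE /=.
  by rewrite addNb.
rewrite inE => /forallP sP.
have s_true i : s (true, i) = pm_opp (s (false, i)).
  by apply/eqP; apply: sP (false, i).
have inj2 : injective (fun i => (s (false, i)).2).
  move=> i j eij; case: (altP ((s (false, i)).1 =P (s (false, j)).1)) => [e1|ne1].
    have /perm_inj[] : s (false, i) = s (false, j).
      by rewrite [LHS]surjective_pairing [RHS]surjective_pairing e1 eij.
    by [].
  (* Opposite signs would give s(i) = -s(j) = s(-j), with arguments of different sign. *)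
  have /perm_inj[//] : s (false, i) = s (true, j).
  rewrite s_true /pm_opp -eij; move: ne1; case: (s (false, i)) => [b k] /=.
  by case: b; case: (s (false, j)).1.
exists (perm inj2, [ffun i => (s (false, i)).1]) => //.
apply/permP=> -[[] i]; rewrite signed_permE /= permE ffunE /=.
  by rewrite s_true.
by case: (s (false, i)).
Qed.

(** * Maps sorted by a permutation *)

Section Compatible.

Variables (n m : nat).
Implicit Types (s : 'S_n) (f : {ffun 'I_n -> bool * 'I_m.+1}).

(* The pair [f j = (b, v)] encodes [(-1)^b * v], so that [(true, 0)] is a
   spurious code; starting [compatible] at [(0, 0)] rules it out. *)
Definition key f (j : 'I_n) : nat *l int := (val (f j).2, pm_val ((f j).1, j)).

(** The lexicographic order compares |f(j)| first and breaks ties by the signed index; the start (0,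
    0) encodes c_0 = 0 and pi(0) = 0. *)
Definition compatible s f :=
  path <%O ((0%N, 0) : nat *l int) [seq key f (s i) | i <- enum 'I_n].

Lemma key_inj f : injective (key f).
Proof. by move=> i j [_ /pm_val_inj[]]. Qed.

Lemma key_gt0 f j :
  (((0%N, 0) : nat *l int) < key f j)%O = ~~ ((f j).1 && (val (f j).2 == 0%N)).
Proof.
rewrite ltxi_pair /= leEnat; case: (f j) => [b [v lt_v]] /=.
by case: b; rewrite /pm_val /= ?expr1 ?expr0; lia.
Qed.

(** Keys are distinct, so exactly one permutation sorts them; a spurious code has its key below the
    start (0, 0) and excludes every permutation. *)
Lemma card_compatible f :
  #|[set s | compatible s f]| = [forall j, ~~ ((f j).1 && (val (f j).2 == 0%N))].
Proof.
have compE s : compatible s f =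
    [forall j, ~~ ((f j).1 && (val (f j).2 == 0%N))] &&
    sorted <%O [seq key f (s i) | i <- enum 'I_n].
  rewrite /compatible path_sortedE; last exact: lt_trans.
  congr (_ && _); apply/allP/forallP=> [gt0 j|gt0 _ /mapP[i _ ->]].
    rewrite -key_gt0; apply: gt0; apply/mapP; exists ((s^-1)%g j).
      by rewrite mem_enum.
    by rewrite permKV.
  by rewrite key_gt0.
case: forallP => [gt0|not_gt0].
  rewrite -[RHS](card_sorting_perms (@key_inj f)).
  by apply: eq_card => s; rewrite !inE compE; case: forallP.
by apply: eq_card0 => s; rewrite !inE compE; case: forallP.
Qed.

Definition pair_of_sorted s f : {ffun 'I_n -> bool} * {ffun 'I_n -> 'I_m.+1} :=
  ([ffun i => (f (s i)).1], [ffun i => (f (s i)).2]).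

Lemma pair_of_sorted_bij s : bijective (pair_of_sorted s).
Proof.
exists (fun ec : {ffun 'I_n -> bool} * {ffun 'I_n -> 'I_m.+1} =>
  [ffun j => (ec.1 ((s^-1)%g j), ec.2 ((s^-1)%g j))]).
  by move=> f; apply/ffunP=> j; rewrite !ffunE permKV -surjective_pairing.
by case=> e c; congr pair; apply/ffunP=> i; rewrite !ffunE /= permK.
Qed.

(** The second components of the sorted keys form the window [w]. Its consecutive entries differ, so
    a lexicographic increase is a weak increase of c, strict exactly where [w] descends. *)
Lemma compatible_step s f :
  let w := window (signed_perm (s, (pair_of_sorted s f).1)) in
  compatible s f =
  ((pair_of_sorted s f).2 \in
     step_seqs n m (fun i => (nth 0 w i < nth 0 (0 :: w) i)%R)).
Proof.
move=> w; rewrite inE.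
have wE (i : 'I_n) : nth 0 w i = (key f (s i)).2.
  by rewrite nth_window signed_permE /= ffunE.
set cs := [seq _ | _ <- _].
have csE (i : 'I_n) : nth 0%N cs i = (key f (s i)).1.
  by rewrite nth_map_enum_ord ffunE.
set x0 : nat *l int := (0%N, 0).
have stepE (i : 'I_n) :
    (nth x0 (x0 :: [seq key f (s i) | i <- enum 'I_n]) i
       < nth x0 [seq key f (s i) | i <- enum 'I_n] i)%O =
    (nth 0 (0 :: cs) i + (nth 0 w i < nth 0 (0 :: w) i)%R
       <= (pair_of_sorted s f).2 i)%N.
  have -> : nth x0 (x0 :: [seq key f (s i) | i <- enum 'I_n]) i
      = (nth 0%N (0%N :: cs) i, nth 0 (0 :: w) i).
    case: i => -[|k] //= lt_kn; have lt_k := ltnW lt_kn.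
    by rewrite -[k]/(val (Ordinal lt_k)) nth_map_enum_ord csE wE.
  (* At the first position no letter equals 0; later, [s] is injective. *)
  have neq : nth 0 w i != nth 0 (0 :: w) i.
    rewrite wE /=; case: i => -[|k] /= lt_kn.
      by rewrite /pm_val; case: (f _).1; rewrite /= ?expr1 ?expr0; lia.
    have lt_k := ltnW lt_kn.
    rewrite -[k in nth 0 w k]/(val (Ordinal lt_k)) wE.
    apply/eqP=> /pm_val_inj[_ /perm_inj /(congr1 val) /=]; lia.
  rewrite nth_map_enum_ord [key f (s i)]surjective_pairing -wE ltxi_pair !leEnat ffunE /=.
  case: ltgtP neq => // _ _; rewrite ?implybT ?implybF; lia.
apply/(pathP x0)/forallP => [step i|step i].
  by rewrite -stepE; apply: step; rewrite size_map size_enum_ord.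
rewrite size_map size_enum_ord => lt_in.
by have := step (Ordinal lt_in); rewrite -stepE.
Qed.

End Compatible.

(** * Assembling the identity *)

Lemma sum_eulerB (n : nat) (a : nat -> {poly int}) : (0 < n)%N ->
  \sum_(0 <= k < n.+1) a k * eulerB n k =
  \sum_(s in signed_perms n) a (desB s) * 'X^(neg s).
Proof.
move=> n_gt0.
have des_lt (s : {perm (pm n)}) : (desB s < n.+1)%N.
  rewrite ltnS desB_sum // big_mkord -[X in (_ <= X)%N]card_ord -sum1_card.
  by apply: leq_sum => i _; case: (_ < _)%R.
rewrite big_mkord [RHS](partition_big (fun s => Ordinal (des_lt s)) xpredT) //=.
apply: eq_bigr => k _; rewrite /eulerB big_distrr /=.
by apply: eq_bigr => s /andP[_ /eqP <-].
Qed.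

Theorem theorem3p1 (n m : nat) (hn : (1 <= n)%N) :
  (1 + (1 + 'X) * m%:R) ^+ n
  = \sum_(0 <= k < n.+1) 'C(n + m - k, n)%:R * eulerB n k :> {poly int}.
Proof.
rewrite (sum_eulerB (fun k => 'C(n + m - k, n)%:R)) // signed_permsE.
rewrite big_imset /=; last by move=> p p' _ _; apply: signed_perm_inj.
(* Weight 0 on the spurious code leaves m + 1 nonnegative values of weight 1 and m negative ones of
   weight q. *)
pose w (x : bool * 'I_m.+1) : {poly int} :=
  if x.1 && (val x.2 == 0%N) then 0 else 'X^(x.1).
have sum_w : \sum_x w x = 1 + (1 + 'X) * m%:R.
  rewrite -(pair_bigA _ (fun b v => w (b, v))) /= big_bool /w /= !big_ord_recl /=.
  rewrite !sumr_const !card_ord expr0 expr1 add0r mulrDl mul1r mulr_natr.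
  by rewrite addrC addrA.
rewrite -sum_w -[in LHS](card_ord n) -prodr_const bigA_distr_bigA /=.
(* Each [f] of nonzero weight has one compatible [s]; the others have none and contribute 0 to both
   sides. *)
transitivity (\sum_(s : 'S_n) \sum_(f : {ffun 'I_n -> bool * 'I_m.+1} | compatible s f)
    \prod_i 'X^((f i).1) : {poly int}).
  rewrite (exchange_big_dep xpredT) //=; apply: eq_bigr => f _.
  rewrite sumr_const -[#|_|]/(#|[pred s | compatible s f]|) -cardsE card_compatible.
  case: forallP => [gt0|not_gt0].
    by apply: eq_bigr => i _; rewrite /w (negPf (gt0 i)).
  case: (pickP (fun i => (f i).1 && (val (f i).2 == 0%N))) => [i i0|no_i].
    by rewrite (bigD1 i) //= /w i0 mul0r.
  by case: not_gt0 => i; rewrite no_i.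
pose G (p : 'S_n * {ffun 'I_n -> bool}) : {poly int} :=
  'C(n + m - desB (signed_perm p), n)%:R * 'X^(neg (signed_perm p)).
have -> : \sum_(p in setT) G p = \sum_s \sum_e G (s, e).
  by rewrite pair_bigA; apply: eq_big => [p|[]//]; rewrite in_setT.
apply: eq_bigr => s _.
pose D e := fun i => let v := window (signed_perm (s, e)) in
  (nth 0 v i < nth 0 (0 :: v) i)%R.
(* For fixed [s], the signs [e] alone fix the signed permutation, hence its descents and the power
   of q; only the number of sequences c is left to count. *)
transitivity (\sum_(ec : {ffun 'I_n -> bool} * {ffun 'I_n -> 'I_m.+1} |
    ec.2 \in step_seqs n m (D ec.1)) 'X^(neg (signed_perm (s, ec.1))) : {poly int}).
  rewrite [RHS](reindex _ (onW_bij _ (pair_of_sorted_bij m s))) /=.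
  apply: eq_big => [f|f _]; first exact: compatible_step.
  rewrite prodrXr neg_sum; congr ('X^_).
  rewrite (reindex_inj (@perm_inj _ s)) /=.
  by apply: eq_bigr => i _; rewrite signed_permE ffunE.
rewrite -(pair_big_dep xpredT (fun e c => c \in step_seqs n m (D e))
  (fun e _ => 'X^(neg (signed_perm (s, e))))) /=.
apply: eq_bigr => e _; rewrite sumr_const card_step_seqs //.
by rewrite /G desB_sum // mulr_natl.
Qed.
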